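(* For every integer $n \ge 3$, let $f_1 = f_1^{(n)}$ and $f_n = f_n^{(n)}$ be differentiable functions from $\mathbb{R}^2$ to $\mathbb{R}$, let $f_i = f_i^{(n)}$, $i=2,\ldots,n-1$, be differentiable functions from $\mathbb{R}^3$ to $\mathbb{R}$, and consider the discrete-time dynamical system on $\mathbb{R}^n$ (with $t=0,1,2,\ldots$) $$x_1(t+1) = f_1(x_1(t),x_2(t)),$$ $$x_i(t+1) = f_i(x_i(t),x_{i-1}(t),x_{i+1}(t)), \quad i=2,\ldots,n-1,$$ $$x_n(t+1) = f_n(x_{n-1}(t),x_n(t)).$$ Suppose that there exists a function $\tau(n,\epsilon)$, with values in the nonnegative integers, such that $$\frac{\|x(t)-\bar{x}\mathbf{1}\|_2}{\|x(0)-\bar{x}\mathbf{1}\|_2} < \epsilon$$ for all $n\ge 3$ and all $\epsilon>0$, all integers $t \ge \tau(n,\epsilon)$, and all initial conditions $x(0)=(x_1(0),\ldots,x_n(0)) \in \mathbb{R}^n$ for which not all $x_i(0)$ are equal. Then $$\tau(n,\epsilon) \ge \frac{n^2}{30}\log\frac{1}{\epsilon}$$ for all $\epsilon>0$ and all integers $n\ge 3$.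
   Context: Here $x(t)=(x_1(t),\ldots,x_n(t))\in\mathbb{R}^n$, $\mathbf{1}\in\mathbb{R}^n$ is the vector with all entries equal to one, $\bar{x} = \frac{1}{n}\sum_{i=1}^n x_i(0)$ is the average of the initial values, $\|\cdot\|_2$ is the Euclidean norm, and $\log$ is the natural logarithm. *)

(* Defs.v *)
From HB Require Import structures.
From mathcomp Require Import all_boot all_order all_algebra.
From mathcomp Require Import all_classical all_reals all_analysis.

Set Implicit Arguments.
Unset Strict Implicit.
Unset Printing Implicit Defensive.

Import Order.TTheory GRing.Theory Num.Theory.
Import numFieldNormedType.Exports.

Local Open Scope ring_scope.

(* The norm that MathComp-Analysis puts on 'rV[R]_n is the sup norm. *)
Definition norm2 (R : realType) (n : nat) (v : 'rV[R]_n) : R :=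
  Num.sqrt (\sum_(i < n) v 0 i ^+ 2).

Definition average (R : realType) (n : nat) (v : 'rV[R]_n) : R :=
  n%:R^-1 * \sum_(i < n) v 0 i.

(* Coordinates are numbered from 0 to n - 1.  The cyclic neighbours ordS and
   ord_pred never wrap around here: ordS is only used at i < n - 1 and ord_pred
   only at 0 < i.  The values of fmid at the two end indices are not used. *)
Definition line_step (R : realType) (n : nat) (ffirst : R * R -> R)
    (fmid : 'I_n -> R * R * R -> R) (flast : R * R -> R)
    (v : 'rV[R]_n) : 'rV[R]_n :=
  \row_(i < n)
    if (i == 0 :> nat)%N then ffirst (v 0 i, v 0 (ordS i))
    else if (i == n.-1 :> nat)%N then flast (v 0 (ord_pred i), v 0 i)
    else fmid i (v 0 i, v 0 (ord_pred i), v 0 (ordS i)).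

Definition trajectory (R : realType) (n : nat) (ffirst : R * R -> R)
    (fmid : 'I_n -> R * R * R -> R) (flast : R * R -> R)
    (x0 : 'rV[R]_n) (t : nat) : 'rV[R]_n :=
  iter t (line_step ffirst fmid flast) x0.

(* Main.v *)
Require Import Defs.
From HB Require Import structures.
From mathcomp Require Import all_boot all_order all_algebra.
From mathcomp Require Import all_classical all_reals all_analysis.
From mathcomp Require Import ring lra zify.

Set Implicit Arguments.
Unset Strict Implicit.
Unset Printing Implicit Defensive.

Import Order.TTheory GRing.Theory Num.Theory.
Import numFieldNormedType.Exports.

Local Open Scope ring_scope.

(** Write F for one step of the system on R^n and tau for tau(n, .).

    Linearization. Letting an initial condition tend to a consensus vector c 1
    in the hypothesis shows that F^t fixes c 1 for all large t, hence that F
    does (consensus_fixed). Applying the hypothesis to x(0) = h v, dividing by h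
    and letting h tend to 0 shows that the differential L of F at 0 satisfies
    |L^t v - avg(v) 1| <= eps |v - avg(v) 1| for t >= tau(eps)
    (differential_averaging). So L fixes 1 and preserves the average. It is
    tridiagonal as well, so its matrix A has all row and column sums equal to 1,
    and comparing the flow of A in both directions across each cut of the line
    shows that A is symmetric (tridiagonal_sym).

    From tau(eps) steps to one step. For a symmetric A the ratio
    |A^(k+1) u| / |A^k u| is nondecreasing in k, because
    |A^(k+1) u|^2 = <A^k u, A^(k+2) u> <= |A^k u| |A^(k+2) u|. Hence if eps < rho^tau(eps), then A
    contracts the zero-sum vectors by rho (differential_contraction).

    A line mixes slowly. A contraction by rho puts the quadratic form of A
    between -rho and rho on zero-sum vectors. Its values at the projections of
    the basis vectors give tr A >= 1 - rho (n - 1) (trace_lower). At the linear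
    profile u_i = i - (n - 1)/2, neighbours differ by 1, so tridiagonality gives
    2 |u|^2 - 2 <u, A u> = n - tr A, while |u|^2 = n (n^2 - 1)/12. Together,
    n (n + 1) (1 - rho) <= 6 (1 + rho) (line_spectral_gap). With
    rho = exp(- 30 / n^2) this inequality fails for n >= 3, which excludes
    eps < rho^tau(eps); taking logarithms gives the bound. *)

(** * Tridiagonal matrices with unit row and column sums *)

Section LinearAlgebra.
Variables (R : realFieldType) (n : nat).
Implicit Types (A : 'M[R]_n) (u v w : 'rV[R]_n).

Definition dot u v : R := \sum_(i < n) u 0 i * v 0 i.

Lemma dot_sym u v : dot u v = dot v u.
Proof. by apply: eq_bigr => i _; rewrite mulrC. Qed.

Lemma dotv_ge0 u : 0 <= dot u u.
Proof. by apply: sumr_ge0 => i _; rewrite -expr2 sqr_ge0. Qed.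

Lemma coord_sqr_le u i : u 0 i ^+ 2 <= dot u u.
Proof.
rewrite /dot (bigD1 i) //= -expr2 lerDl.
by apply: sumr_ge0 => j _; rewrite -expr2 sqr_ge0.
Qed.

Lemma dot_mulmx A u v : dot (u *m A) v = dot u (v *m A^T).
Proof.
have dotE w z : dot w z = (w *m z^T) 0 0.
  by rewrite mxE; apply: eq_bigr => i _; rewrite mxE.
by rewrite !dotE trmx_mul trmxK mulmxA.
Qed.

Lemma dot_sub_sqr (a : R) u v :
  dot (u - a *: v) (u - a *: v) = dot u u - 2 * a * dot u v + a ^+ 2 * dot v v.
Proof.
rewrite /dot !mulr_sumr -sumrB -big_split /=.
by apply: eq_bigr => i _; rewrite !mxE; ring.
Qed.

Definition tridiagonal A : Prop :=
  forall i j : 'I_n, ((i.+1 < j) || (j.+1 < i))%N -> A i j = 0.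

(** The entries may be negative: the linearized system need not be a Markov chain. *)
Definition doubly_stochastic A : Prop :=
  (forall i, \sum_(j < n) A i j = 1) /\ (forall j, \sum_(i < n) A i j = 1).

(** The rows indexed by P and the columns indexed by P have the same total, and
    they share the block P x P. *)
Lemma cut_balance A (P : pred 'I_n) : doubly_stochastic A ->
  \sum_(i | P i) \sum_(j | ~~ P j) A i j = \sum_(i | P i) \sum_(j | ~~ P j) A j i.
Proof.
move=> [rowA colA]; apply: (addrI (\sum_(i | P i) \sum_(j | P j) A i j)).
rewrite [in RHS]exchange_big -!big_split /=.
transitivity (\sum_(i | P i) (1 : R)); apply: eq_bigr => i Pi.
  by rewrite -(rowA i) [RHS](bigID P).
by rewrite -(colA i) (bigID P).
Qed.

(** A cut of the line between two neighbours is crossed by one entry of A in each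
    direction, so cut_balance compares just these two entries. *)
Lemma tridiagonal_sym A : tridiagonal A -> doubly_stochastic A -> A^T = A.
Proof.
move=> triA dsA.
have up (i j : 'I_n) : (j = i.+1 :> nat) -> A i j = A j i.
  move=> ji; have := cut_balance (fun k : 'I_n => (k < j)%N) dsA.
  have red (B : 'I_n -> 'I_n -> R) : (forall k l : 'I_n, (k.+1 < l)%N -> B k l = 0) ->
      \sum_(k < n | (k < j)%N) \sum_(l < n | ~~ (l < j)%N) B k l = B i j.
    move=> B0; rewrite (bigD1 i) ?ji //= (bigD1 j) ?ji ?ltnn //=.
    rewrite big1 => [|l /andP[lj /eqP lNj]]; last first.
      by apply: B0; have /eqP := lNj; rewrite -val_eqE /=; lia.
    rewrite addr0 big1 ?addr0 // => k /andP[kj kNi].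
    apply: big1 => l lj; apply: B0; move: kNi; rewrite -val_eqE /=; lia.
  rewrite red => [|k l kl]; last by rewrite triA ?kl.
  by rewrite (red (fun k l => A l k)) // => k l kl; rewrite triA ?kl ?orbT.
apply/matrixP => i j; rewrite mxE.
have [ij|ji|/val_inj-> //] := ltngtP i j.
  have [/eqP ijS|ijS] := boolP (j == i.+1 :> nat); first by rewrite (up i j).
  by rewrite !triA //; apply/orP; lia.
have [/eqP ijS|ijS] := boolP (i == j.+1 :> nat); first by rewrite (up j i).
by rewrite !triA //; apply/orP; lia.
Qed.

(** Growth ratios of a symmetric matrix do not decrease along an orbit: with
    y_k = u A^k, expanding |y_(k+2) - rho^2 y_k|^2 >= 0 and using
    <y_(k+2), y_k> = |y_(k+1)|^2 turns |y_(k+1)| >= rho |y_k| into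
    |y_(k+2)| >= rho |y_(k+1)|. This stands in for the spectral theorem. *)
Lemma iter_growth A (rho : R) u : A^T = A -> 0 <= rho ->
    rho ^+ 2 * dot u u <= dot (u *m A) (u *m A) ->
  forall k, rho ^+ (2 * k) * dot u u
    <= dot (iter k (mulmx^~ A) u) (iter k (mulmx^~ A) u).
Proof.
move=> symA rho0 u1; pose y k := iter k (mulmx^~ A) u.
have step k : rho ^+ 2 * dot (y k) (y k) <= dot (y k.+1) (y k.+1).
  elim: k => [//|k IH].
  have := dotv_ge0 (y k.+2 - rho ^+ 2 *: y k).
  have -> : dot (y k.+2 - rho ^+ 2 *: y k) (y k.+2 - rho ^+ 2 *: y k)
     = dot (y k.+2) (y k.+2) - 2 * rho ^+ 2 * dot (y k.+1) (y k.+1)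
        + rho ^+ 4 * dot (y k) (y k).
    have shift : dot (y k.+2) (y k) = dot (y k.+1) (y k.+1).
      by have := dot_mulmx A (y k.+1) (y k); rewrite symA.
    by rewrite dot_sub_sqr shift -exprM.
  have : rho ^+ 2 * (rho ^+ 2 * dot (y k) (y k)) <= rho ^+ 2 * dot (y k.+1) (y k.+1).
    by apply: ler_wpM2l => //; exact: sqr_ge0.
  rewrite mulrA -exprD; lra.
elim=> [|k IH]; first by rewrite muln0 expr0 mul1r.
apply: le_trans (step k); rewrite mulnS exprD -mulrA.
by apply: ler_wpM2l IH; exact: sqr_ge0.
Qed.

(** Expand |u A - rho u|^2 >= 0 and |u A + rho u|^2 >= 0. *)
Lemma rayleigh_bound A (rho : R) u : 0 < rho ->
    dot (u *m A) (u *m A) <= rho ^+ 2 * dot u u ->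
  `|dot u (u *m A)| <= rho * dot u u.
Proof.
move=> rho0 uA.
have P := dotv_ge0 (u *m A - rho *: u); have M := dotv_ge0 (u *m A - (- rho) *: u).
rewrite !dot_sub_sqr (dot_sym (u *m A) u) in P M.
rewrite ler_norml; apply/andP.
by split; rewrite -(ler_pM2l rho0); lra.
Qed.

Lemma laplacian_form A u : doubly_stochastic A ->
  \sum_(i < n) \sum_(j < n) A i j * (u 0 i - u 0 j) ^+ 2
  = 2 * dot u u - 2 * dot u (u *m A).
Proof.
move=> [rowA colA].
have E i j : A i j * (u 0 i - u 0 j) ^+ 2 = u 0 i * u 0 i * A i j
   + (u 0 j * u 0 j * A i j - 2 * (u 0 j * (u 0 i * A i j))) by ring.
under eq_bigr do under eq_bigr do rewrite E.
under eq_bigr do rewrite big_split sumrB -mulr_sumr rowA mulr1 -mulr_sumr /=.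
rewrite big_split sumrB -mulr_sumr /= -/(dot u u) exchange_big /=.
under [X in _ + (X - _)]eq_bigr do rewrite -mulr_sumr colA mulr1.
rewrite -/(dot u u) exchange_big /=.
under [X in _ + (_ - _ * X)]eq_bigr do rewrite -mulr_sumr.
have -> : \sum_(j < n) u 0 j * (\sum_(i < n) u 0 i * A i j) = dot u (u *m A).
  by apply: eq_bigr => j _; rewrite mxE.
ring.
Qed.

(** Sum the bound over the projections e_k - 1/n of the basis vectors, on which
    the quadratic form of A is A_kk - 1/n. *)
Lemma trace_lower A (rho : R) : (0 < n)%N -> doubly_stochastic A ->
    (forall u, \sum_(i < n) u 0 i = 0 -> `|dot u (u *m A)| <= rho * dot u u) ->
  1 - rho * (n%:R - 1) <= \tr A.
Proof.
move=> n0 [rowA colA] rayA.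
have nN0 : n%:R != 0 :> R by rewrite pnatr_eq0 -lt0n.
pose c : R := n%:R^-1.
pose e k : 'rV[R]_n := \row_i ((i == k)%:R - c).
have sum1 (k : 'I_n) (f : 'I_n -> R) : \sum_(i < n) (i == k)%:R * f i = f k.
  rewrite (bigD1 k) //= eqxx mul1r big1 ?addr0 // => i /negPf->.
  by rewrite mul0r.
have delta1 (k : 'I_n) : \sum_(i < n) (i == k)%:R = 1 :> R.
  by rewrite -[RHS](sum1 k (fun=> 1)); apply: eq_bigr => i _; rewrite mulr1.
have sumc : \sum_(i < n) c = 1.
  by rewrite sumr_const card_ord -mulr_natl mulfV.
have eA k j : (e k *m A) 0 j = A k j - c.
  rewrite mxE; under eq_bigr do rewrite mxE mulrBl.
  by rewrite sumrB sum1 -mulr_sumr colA mulr1.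
have sume k : \sum_(i < n) e k 0 i = 0.
  by under eq_bigr do rewrite mxE; rewrite sumrB delta1 sumc subrr.
have dote k (f : 'I_n -> R) :
    \sum_(i < n) e k 0 i * (f i - c) = f k - c * \sum_(i < n) f i.
  under eq_bigr do rewrite mulrBr.
  rewrite sumrB -mulr_suml sume mul0r subr0.
  under eq_bigr do rewrite mxE mulrBl.
  by rewrite sumrB sum1 mulr_sumr.
have dk k : - (rho * (1 - c)) <= A k k - c.
  have := rayA _ (sume k); rewrite ler_norml => /andP[+ _].
  have -> : dot (e k) (e k *m A) = A k k - c.
    by rewrite /dot; under eq_bigr do rewrite eA; rewrite dote rowA mulr1.
  have -> // : dot (e k) (e k) = 1 - c.
  rewrite /dot; under eq_bigr => i _ do rewrite [e k 0 i in X in _ * X]mxE.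
  rewrite (dote k (fun i => (i == k)%:R)) eqxx.
  by rewrite delta1 mulr1.
have : \sum_(k < n) - (rho * (1 - c)) <= \sum_(k < n) (A k k - c).
  by apply: ler_sum => k _; exact: dk.
rewrite /mxtrace sumrB sumc sumr_const card_ord -[X in X <= _ -> _]mulr_natl.
have -> : n%:R * - (rho * (1 - c)) = - (rho * (n%:R - 1)) by rewrite /c; field.
lra.
Qed.

End LinearAlgebra.

Lemma sum_centered_sqr (R : realFieldType) (n : nat) :
  12 * (\sum_(i < n) (i%:R - (n%:R - 1) / 2) ^+ 2) = n%:R * (n%:R ^+ 2 - 1) :> R.
Proof.
have gen (c : R) : 6 * (\sum_(i < n) (i%:R - c) ^+ 2)
   = n%:R * (n%:R - 1) * (2 * n%:R - 1) - 6 * c * n%:R * (n%:R - 1) + 6 * n%:R * c ^+ 2.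
  (* The induction needs a center that does not depend on n. *)
  elim: n => [|n IH]; first by rewrite big_ord0; ring.
  by rewrite big_ord_recr mulrDr IH -natr1; ring.
have := gen ((n%:R - 1) / 2); lra.
Qed.

Lemma sum_centered (R : realFieldType) (n : nat) :
  \sum_(i < n) (i%:R - (n%:R - 1) / 2) = 0 :> R.
Proof.
have gen (c : R) : \sum_(i < n) (i%:R - c) = n%:R * (n%:R - 1) / 2 - c * n%:R.
  elim: n => [|n IH]; first by rewrite big_ord0; ring.
  by rewrite big_ord_recr IH -natr1 /=; field.
by rewrite gen; field.
Qed.

(** Test the contraction on the linear profile u_i = i - (n - 1)/2: it is nearly
    the slowest mode of the line. Only neighbouring pairs contribute to
    laplacian_form, each with weight (u_i - u_j)^2 = 1, so the form is the total
    of the off-diagonal entries, n - tr A. *)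
Lemma line_spectral_gap (R : realFieldType) (n : nat) (A : 'M[R]_n) (rho : R) :
    (1 < n)%N -> tridiagonal A -> doubly_stochastic A -> 0 < rho ->
    (forall u : 'rV[R]_n, \sum_(i < n) u 0 i = 0 ->
       dot (u *m A) (u *m A) <= rho ^+ 2 * dot u u) ->
  n%:R * (n%:R + 1) * (1 - rho) <= 6 * (1 + rho).
Proof.
move=> n1 triA dsA rho0 uA.
have rayA (u : 'rV[R]_n) (su : \sum_(i < n) u 0 i = 0) := rayleigh_bound rho0 (uA u su).
have trA := trace_lower (ltnW n1) dsA rayA.
pose u : 'rV[R]_n := \row_i (i%:R - (n%:R - 1) / 2).
have su : \sum_(i < n) u 0 i = 0.
  by under eq_bigr do rewrite mxE; exact: sum_centered.
have uu : 12 * dot u u = n%:R * (n%:R ^+ 2 - 1).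
  rewrite -sum_centered_sqr; congr (_ * _).
  by apply: eq_bigr => i _; rewrite mxE expr2.
have lap : 2 * dot u u - 2 * dot u (u *m A) = n%:R - \tr A.
  rewrite -laplacian_form // /mxtrace.
  have -> : n%:R = \sum_(i < n) \sum_(j < n) A i j.
    under eq_bigr do rewrite (proj1 dsA).
    by rewrite sumr_const card_ord.
  rewrite -sumrB; apply: eq_bigr => i _.
  rewrite (bigD1 i) // [in RHS](bigD1 i) //= subrr expr0n mulr0 add0r addrAC subrr add0r.
  apply: eq_bigr => j jNi.
  have [far|near] := boolP ((i.+1 < j) || (j.+1 < i))%N.
    by rewrite triA // mul0r.
  rewrite !mxE.
  have : (i = j.+1 :> nat) \/ (j = i.+1 :> nat).
    by move: near jNi; rewrite -val_eqE /=; lia.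
  by case=> ->; rewrite -natr1; ring.
have := rayA u su; rewrite ler_norml => /andP[_ ray].
have n1R : 0 < n%:R - 1 :> R by rewrite subr_gt0 ltr1n.
rewrite -(ler_pM2l n1R).
have -> : (n%:R - 1) * (n%:R * (n%:R + 1) * (1 - rho))
   = n%:R * (n%:R ^+ 2 - 1) * (1 - rho) by ring.
rewrite -uu; lra.
Qed.

(** * The linearization of a line system *)

Section LineSystem.
Variables (R : realType) (n : nat).
Variables (ff : R * R -> R) (fm : 'I_n -> R * R * R -> R) (fl : R * R -> R).

(** The differential of line_step at 0 is a line system again, whose local rules
    are the differentials of the local rules. *)
Definition line_differential : 'rV[R]_n -> 'rV[R]_n :=
  line_step ('d ff (0, 0)) (fun i => 'd (fm i) (0, 0, 0)) ('d fl (0, 0)).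

Lemma line_differential_linear : linear line_differential.
Proof.
move=> a u v; apply/rowP => i; rewrite !mxE.
case: ifP => _; first by rewrite -[_ *: _ + _ in RHS]linearP.
by case: ifP => _; rewrite -[_ *: _ + _ in RHS]linearP.
Qed.

Definition line_jacobian : 'M[R]_n :=
  \matrix_(i, j) line_differential (delta_mx 0 i) 0 j.

Lemma line_differentialE u : line_differential u = u *m line_jacobian.
Proof.
pose L : {linear 'rV[R]_n -> 'rV[R]_n} :=
  HB.pack line_differential
    (GRing.isLinear.Build _ _ _ _ _ line_differential_linear).
rewrite -[LHS]/(L u) -mul_rV_lin1; congr (_ *m _).
by apply/matrixP => i j; rewrite !mxE.
Qed.

(** Row i is the image of the basis vector e_i, and the rule at j reads only the
    coordinates j - 1, j and j + 1, which vanish on e_i when i is further away. *)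
Lemma line_jacobian_tridiagonal : (1 < n)%N -> tridiagonal line_jacobian.
Proof.
move=> n1 i j far; rewrite !mxE.
have ji : (j == i) = false by apply/negP => /eqP ji; move: far; rewrite ji; lia.
have jlt := ltn_ord j; have ilt := ltn_ord i.
have [j0|jN0] := eqVneq (j : nat) 0%N.
  have Sj : (ordS j == i) = false.
    by apply/negP => /eqP/(congr1 val)/=; rewrite modn_small; lia.
  by rewrite !eqxx ji Sj !andbF; exact: linear0.
have Pj : (ord_pred j == i) = false.
  apply/negP => /eqP/(congr1 val)/=.
  have -> : (j + n).-1 = (j.-1 + n)%N by lia.
  by rewrite modnDr modn_small; lia.
have [jn|jNn] := eqVneq (j : nat) n.-1.
  by rewrite eqxx ji Pj !andbF; exact: linear0.
have Sj : (ordS j == i) = false.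
  by apply/negP => /eqP/(congr1 val)/=; rewrite modn_small; lia.
by rewrite eqxx ji Pj Sj !andbF; exact: linear0.
Qed.

Hypothesis dff : forall p, differentiable ff p.
Hypothesis dfm : forall i : 'I_n, (0 < i < n.-1)%N ->
  forall p, differentiable (fm i) p.
Hypothesis dfl : forall p, differentiable fl p.

Local Notation F := (line_step ff fm fl).
Local Notation L := line_differential.

(** Differentiability is followed along curves, one coordinate at a time, so that
    each step only involves real functions of one real variable. *)
Lemma line_step_differentiable (g : R -> 'rV[R]_n) :
    (forall i, differentiable (fun h => g h 0 i) 0) ->
  forall i, differentiable (fun h => F (g h) 0 i) 0.
Proof.
move=> dg i.
have [i0|iN0] := eqVneq (i : nat) 0%N.
  under eq_fun do rewrite mxE i0 eqxx.
  by apply: (@differentiable_comp _ _ _ _ (fun h => (g h 0 i, g h 0 (ordS i))) ff);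
    [exact: differentiable_pair|exact: dff].
have [ilast|iNlast] := eqVneq (i : nat) n.-1.
  under eq_fun do rewrite mxE (negPf iN0) ilast eqxx.
  by apply: (@differentiable_comp _ _ _ _ (fun h => (g h 0 (ord_pred i), g h 0 i)) fl);
    [exact: differentiable_pair|exact: dfl].
under eq_fun do rewrite mxE (negPf iN0) (negPf iNlast).
apply: (@differentiable_comp _ _ _ _
  (fun h => (g h 0 i, g h 0 (ord_pred i), g h 0 (ordS i))) (fm i)).
  by apply: differentiable_pair => //; exact: differentiable_pair.
by apply: dfm; have := ltn_ord i; lia.
Qed.

Lemma line_step_diff (g : R -> 'rV[R]_n) (v : 'rV[R]_n) :
    (forall i, differentiable (fun h => g h 0 i) 0) ->
    g 0 = 0 -> (forall i, 'd (fun h => g h 0 i) 0 1 = v 0 i) ->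
  forall i, 'd (fun h => F (g h) 0 i) 0 1 = L v 0 i.
Proof.
move=> dg g0 dgv i; rewrite [in RHS]mxE.
have gi0 j : g 0 0 j = 0 by rewrite g0 mxE.
have [i0|iN0] := eqVneq (i : nat) 0%N.
  under eq_fun do rewrite mxE i0 eqxx.
  rewrite (@diff_comp _ _ _ _ (fun h => (g h 0 i, g h 0 (ordS i))) ff) /=.
  - by rewrite diff_pair //= !gi0 !dgv.
  - exact: differentiable_pair.
  - exact: dff.
have [ilast|iNlast] := eqVneq (i : nat) n.-1.
  under eq_fun do rewrite mxE (negPf iN0) ilast eqxx.
  rewrite (@diff_comp _ _ _ _ (fun h => (g h 0 (ord_pred i), g h 0 i)) fl) /=.
  - by rewrite diff_pair //= !gi0 !dgv.
  - exact: differentiable_pair.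
  - exact: dfl.
under eq_fun do rewrite mxE (negPf iN0) (negPf iNlast).
rewrite (@diff_comp _ _ _ _
  (fun h => (g h 0 i, g h 0 (ord_pred i), g h 0 (ordS i))) (fm i)) /=.
- rewrite diff_pair //=; last exact: differentiable_pair.
  by rewrite diff_pair //= !gi0 !dgv.
- by apply: differentiable_pair => //; exact: differentiable_pair.
- by apply: dfm; have := ltn_ord i; lia.
Qed.

Lemma iter_line_step_differentiable (g : R -> 'rV[R]_n) t :
    (forall i, differentiable (fun h => g h 0 i) 0) ->
  forall i, differentiable (fun h => iter t F (g h) 0 i) 0.
Proof.
move=> dg; elim: t => [//|t IH] i.
exact: (@line_step_differentiable (fun h => iter t F (g h))).
Qed.

Lemma iter_line_step_diff (v : 'rV[R]_n) t : F 0 = 0 ->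
  forall i, 'd (fun h : R => iter t F (h *: v) 0 i) 0 1 = iter t L v 0 i.
Proof.
move=> F0.
have dlin i : differentiable (fun h : R => (h *: v) 0 i) 0.
  by under eq_fun do rewrite mxE; exact: ex_diff.
elim: t => [|t IH] i /=.
  under eq_fun do rewrite mxE.
  by rewrite diff_val /= scale1r.
apply: (@line_step_diff (fun h : R => iter t F (h *: v))) => //.
  exact: iter_line_step_differentiable.
by rewrite scale0r; elim: t {IH} => //= t ->.
Qed.

End LineSystem.

(** * Averages and limits at the origin *)

Local Open Scope classical_set_scope.
Local Open Scope ring_scope.

Lemma le_at0_of_differentiable (R : realType) (f g : R -> R) :
    differentiable f 0 -> differentiable g 0 ->
  (forall h, h != 0 -> f h <= g h) -> f 0 <= g 0.
Proof.
move=> df dg fg; rewrite -subr_ge0.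
have dgf : differentiable (g - f) 0 by exact: differentiableB.
have /continuous_withinNx gf0 := differentiable_continuous dgf.
rewrite -[_ - _]/((g - f) 0); apply: cvgr_to_ge gf0 _.
apply: (filterS _ (nbhs_dnbhs_neq (0 : R))) => h h0.
by rewrite /= subr_ge0; exact: fg.
Qed.

Lemma cvg_difference_quotient (R : realType) (f : R -> R) :
    differentiable f 0 -> f 0 = 0 ->
  (fun h => h^-1 * f h) @ (0 : R)^' --> 'd f 0 1.
Proof.
move=> df f0; have /derivable1_diffP df1 := df.
rewrite -deriveE //; move: df1; rewrite /derivable /derive; set q := fun h => _.
have -> // : q = (fun h => h^-1 * f h).
by apply/funext => h; rewrite /q /= f0 subr0 addr0 [h%:A]mulr1.
Qed.

Lemma norm2E (R : realType) n (v : 'rV[R]_n) : norm2 v = Num.sqrt (dot v v).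
Proof. by congr Num.sqrt; apply: eq_bigr => i _; rewrite expr2. Qed.

Lemma average_affine (R : realType) n (h c : R) (v : 'rV[R]_n) : (0 < n)%N ->
  average (h *: v + const_mx c) = h * average v + c.
Proof.
move=> n0; have nN0 : n%:R != 0 :> R by rewrite pnatr_eq0 -lt0n.
rewrite /average; under eq_bigr do rewrite !mxE.
rewrite big_split -mulr_sumr sumr_const card_ord -[c *+ n]mulr_natl /=.
by field.
Qed.

Definition centered (R : realType) n (v : 'rV[R]_n) : 'rV[R]_n :=
  v - average v *: const_mx 1.

Lemma centered_affine (R : realType) n (h c : R) (v : 'rV[R]_n) : (0 < n)%N ->
  centered (h *: v + const_mx c) = h *: centered v.
Proof.
move=> n0; rewrite /centered average_affine //.
by apply/rowP => i; rewrite !mxE; ring.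
Qed.

Lemma dotZZ (R : realFieldType) n (h : R) (v : 'rV[R]_n) :
  dot (h *: v) (h *: v) = h ^+ 2 * dot v v.
Proof.
by rewrite /dot mulr_sumr; apply: eq_bigr => i _; rewrite !mxE; ring.
Qed.

(** * Line systems that average *)

Section Averaging.
Variables (R : realType) (n : nat).
Variables (ff : R * R -> R) (fm : 'I_n -> R * R * R -> R) (fl : R * R -> R).
Hypothesis n1 : (1 < n)%N.
Hypothesis dff : forall p, differentiable ff p.
Hypothesis dfm : forall i : 'I_n, (0 < i < n.-1)%N ->
  forall p, differentiable (fm i) p.
Hypothesis dfl : forall p, differentiable fl p.
Variable tau : R -> nat.

Local Notation F := (line_step ff fm fl).
Local Notation L := (line_differential ff fm fl).
Local Notation nonconstant v := (~ (forall i j : 'I_n, v 0 i = v 0 j)).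

Hypothesis averaging : forall eps : R, 0 < eps -> forall t, (tau eps <= t)%N ->
  forall x : 'rV[R]_n, nonconstant x ->
  norm2 (iter t F x - average x *: const_mx 1)
    / norm2 (x - average x *: const_mx 1) < eps.

Let n0 : (0 < n)%N := ltnW n1.

Lemma averaging_dot eps t (x : 'rV[R]_n) : 0 < eps -> (tau eps <= t)%N -> nonconstant x ->
  dot (iter t F x - average x *: const_mx 1) (iter t F x - average x *: const_mx 1)
    <= eps ^+ 2 * dot (centered x) (centered x).
Proof.
move=> eps0 tt xN; have := averaging eps0 tt xN.
rewrite -/(centered x) !norm2E; set y := _ - _.
have cx : 0 < dot (centered x) (centered x).
  rewrite lt0r dotv_ge0 andbT; apply/eqP => cx0; apply: xN.
  suff xa i : x 0 i = average x by move=> i j; rewrite !xa.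
  have := coord_sqr_le (centered x) i; rewrite cx0.
  move=> xi; have : (centered x) 0 i == 0.
    by rewrite -sqrf_eq0 eq_le xi sqr_ge0.
  by rewrite !mxE mulr1 subr_eq0 => /eqP.
rewrite ltr_pdivrMr ?sqrtr_gt0 // => /ltW.
rewrite -ler_sqr ?nnegrE ?mulr_ge0 ?sqrtr_ge0 ?(ltW eps0) //.
by rewrite exprMn !sqr_sqrtr ?dotv_ge0.
Qed.

Lemma nonconstant_affine (h c : R) (v : 'rV[R]_n) : h != 0 -> nonconstant v ->
  nonconstant (h *: v + const_mx c).
Proof.
move=> h0 vN hv; apply: vN => i j.
by have := hv i j; rewrite !mxE => /addIr/(mulfI h0).
Qed.

Lemma affine_differentiable (v : 'rV[R]_n) c i :
  differentiable (fun h : R => (h *: v + const_mx c) 0 i) 0.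
Proof. by under eq_fun do rewrite !mxE; exact: ex_diff. Qed.

Lemma nonconstant_delta : nonconstant (delta_mx 0 (Ordinal n0) : 'rV[R]_n).
Proof.
move=> /(_ (Ordinal n0) (Ordinal n1)); rewrite !mxE !eqxx /= => /eqP.
by rewrite oner_eq0.
Qed.

(** Along x(h) = h e_0 + c 1 the hypothesis bounds |F^t x(h) - avg(x(h)) 1| by
    a multiple of |h|, so F^t fixes c 1 for all t >= tau(1). Two consecutive such t
    give the claim. *)
Lemma consensus_fixed c : F (const_mx c) = const_mx c.
Proof.
have late t : (tau 1 <= t)%N -> iter t F (const_mx c) = const_mx c.
  move=> tt; apply/rowP => i; rewrite [RHS]mxE; apply/eqP.
  rewrite -subr_eq0 -sqrf_eq0 eq_le sqr_ge0 andbT.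
  pose v : 'rV[R]_n := delta_mx 0 (Ordinal n0).
  pose x (h : R) := h *: v + const_mx c.
  pose K := dot (centered v) (centered v).
  have dx : differentiable (fun h => iter t F (x h) 0 i) 0.
    by apply: iter_line_step_differentiable => // j; exact: affine_differentiable.
  pose f h := (iter t F (x h) 0 i - (h * average v + c)) ^+ 2.
  pose g (h : R) := h ^+ 2 * K.
  have df : differentiable f 0.
    apply: (@differentiableX _ _ (fun h => iter t F (x h) 0 i - (h * average v + c)) 1%N).
    by apply: differentiableB => //; exact: ex_diff.
  have dg : differentiable g 0 by exact: ex_diff.
  have := le_at0_of_differentiable df dg.
  rewrite /f /g /x scale0r add0r mul0r add0r expr0n mul0r; apply=> h h0.
  have := averaging_dot ltr01 tt (nonconstant_affine (c := c) h0 nonconstant_delta).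
  rewrite centered_affine // average_affine // dotZZ expr1n mul1r.
  apply: le_trans; apply: le_trans (coord_sqr_le _ i).
  by rewrite !mxE mulr1.
by rewrite -[in LHS](late _ (leqnn _)) -iterS late.
Qed.

Lemma differential_consensus c : L (const_mx c) = const_mx c.
Proof.
apply/rowP => i; pose g (h : R) : 'rV[R]_n := const_mx (h * c).
have dg j : differentiable (fun h => g h 0 j) 0.
  by under eq_fun do rewrite mxE; exact: ex_diff.
have dgv j : 'd (fun h => g h 0 j) 0 1 = (const_mx c : 'rV[R]_n) 0 j.
  by under eq_fun do rewrite mxE; rewrite diff_val mxE /= scale1r.
rewrite -(line_step_diff dff dfm dfl dg _ dgv) /g; last by rewrite mul0r.
by under eq_fun do rewrite consensus_fixed; exact: dgv.
Qed.

(** Divide the bound for x(0) = h v by h^2 and let h tend to 0. Constant v, which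
    the hypothesis does not cover, are fixed by L. *)
Lemma differential_averaging (eps : R) t (v : 'rV[R]_n) : 0 < eps -> (tau eps <= t)%N ->
  dot (iter t L v - average v *: const_mx 1) (iter t L v - average v *: const_mx 1)
    <= eps ^+ 2 * dot (centered v) (centered v).
Proof.
move=> eps0 tt; have [vC|vN] := pselect (forall i j, v 0 i = v 0 j).
  have -> : v = const_mx (v 0 (Ordinal n0)).
    by apply/rowP => i; rewrite mxE; exact: vC.
  set c := v 0 _.
  have -> : iter t L (const_mx c) = const_mx c.
    by elim: t {tt} => //= t ->; exact: differential_consensus.
  rewrite -/(centered (const_mx c)).
  have -> : const_mx c = 0 *: const_mx c + const_mx c :> 'rV[R]_n.
    by rewrite scale0r add0r.
  by rewrite centered_affine // dotZZ expr0n mul0r mulr0.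
have F0 : F 0 = 0 by rewrite -[0]/(const_mx 0) consensus_fixed.
have itF0 : iter t F 0 = 0 by elim: t {tt} => //= t ->.
pose q i (h : R) := h^-1 * iter t F (h *: v) 0 i - average v.
have qlim i : q i @ (0 : R)^' --> (iter t L v - average v *: const_mx 1) 0 i.
  rewrite !mxE mulr1; apply: cvgB; last exact: cvg_cst.
  rewrite -(iter_line_step_diff dff dfm dfl _ _ F0).
  apply: cvg_difference_quotient; last by rewrite scale0r itF0 mxE.
  apply: iter_line_step_differentiable => // j.
  by under eq_fun do rewrite mxE; exact: ex_diff.
set l := iter t L v - _ in qlim *.
have sumlim : \sum_(i < n) q i h * q i h @[h --> (0 : R)^'] --> dot l l.
  apply: cvg_big; first exact: add_continuous.
  by move=> i _; exact: cvgM.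
apply: (cvgr_to_le sumlim).
apply: (filterS _ (nbhs_dnbhs_neq (0 : R))) => h h0.
have := averaging_dot eps0 tt (nonconstant_affine (c := 0) h0 vN).
rewrite centered_affine // average_affine // dotZZ !addr0.
set w := _ - _; have -> : w = h *: \row_i q i h.
  by apply/rowP => i; rewrite !mxE /q; field.
rewrite dotZZ mulrCA ler_pM2l ?exprn_even_gt0 //.
by congr (_ <= _); apply: eq_bigr => i _; rewrite !mxE.
Qed.

(** For t = tau(eps), the vector L^(t+1) v is close to avg(v) 1 as an orbit of v
    and close to avg(L v) 1 as an orbit of L v. *)
Lemma average_differential v : average (L v) = average v.
Proof.
pose d := average (L v) - average v.
pose C := dot (centered v) (centered v) + dot (centered (L v)) (centered (L v)).
have coord (w : 'rV[R]_n) a i : (w - a *: const_mx 1) 0 i = w 0 i - a.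
  by rewrite !mxE mulr1.
(* Compare coordinate 0, with (p - q)^2 <= 2 p^2 + 2 q^2. *)
have bound eps : 0 < eps -> d ^+ 2 <= 2 * eps ^+ 2 * C.
  move=> eps0; pose t := tau eps.
  have tt : (tau eps <= t.+1)%N by exact: leqnSn.
  have := differential_averaging v eps0 tt.
  have := differential_averaging (L v) eps0 (leqnn _).
  rewrite -iterSr -/t; set y := iter t.+1 L v.
  move=> /(le_trans (coord_sqr_le _ (Ordinal n0))) Lv.
  move=> /(le_trans (coord_sqr_le _ (Ordinal n0))).
  move: Lv; rewrite !coord /d /C.
  set z := y 0 _ => zLv zv.
  have := sqr_ge0 (z - average (L v) + (z - average v)).
  by nra.
have C0 : 0 <= C by rewrite addr_ge0 ?dotv_ge0.
apply/eqP; rewrite -subr_eq0 -/d -sqrf_eq0 eq_le sqr_ge0 andbT.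
rewrite leNgt; apply/negP => d0.
(* An eps whose square makes the bound smaller than d^2 / 2. *)
pose e2 := d ^+ 2 / (4 * (C + 1)).
have e20 : 0 < e2 by rewrite divr_gt0 //; lra.
have := bound (Num.sqrt e2); rewrite sqrtr_gt0 sqr_sqrtr ?(ltW e20) // => /(_ e20).
have : e2 * (4 * (C + 1)) = d ^+ 2 by rewrite divfK //; apply: lt0r_neq0; lra.
nra.
Qed.

Lemma sum_average (v : 'rV[R]_n) : \sum_(i < n) v 0 i = n%:R * average v.
Proof. by rewrite mulVKf // pnatr_eq0 -lt0n. Qed.

Lemma line_jacobian_doubly_stochastic :
  doubly_stochastic (line_jacobian ff fm fl).
Proof.
split=> [i|j].
  under eq_bigr do rewrite mxE.
  rewrite sum_average average_differential -sum_average (bigD1 i) //= big1.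
    by rewrite mxE !eqxx addr0.
  by move=> k /negPf ki; rewrite mxE ki andbF.
have := differential_consensus 1; rewrite line_differentialE => /rowP/(_ j).
rewrite [X in X = _]mxE [X in _ = X]mxE => <-.
by apply: eq_bigr => i _; rewrite [const_mx _ _ _]mxE mul1r.
Qed.

(** A vector u that violates the contraction would grow at least like rho^k by
    iter_growth, against the decay by eps at time tau(eps). *)
Lemma differential_contraction eps (rho : R) (u : 'rV[R]_n) :
    0 < eps -> 0 < rho -> eps < rho ^+ tau eps -> \sum_(i < n) u 0 i = 0 ->
  dot (L u) (L u) <= rho ^+ 2 * dot u u.
Proof.
move=> eps0 rho0 eps_rho su.
have symA := tridiagonal_sym (line_jacobian_tridiagonal ff fm fl n1)
  line_jacobian_doubly_stochastic.
have au : average u = 0 by rewrite /average su mulr0.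
rewrite leNgt; apply/negP => grow.
have uu : 0 < dot u u.
  rewrite lt0r dotv_ge0 andbT; apply/eqP => uu0.
  suff u0 : u = 0.
    move: grow; rewrite u0 line_differentialE mul0mx.
    by rewrite /dot big1 ?mulr0 ?ltxx // => i _; rewrite mxE mul0r.
  apply/rowP => i; apply/eqP; rewrite mxE -sqrf_eq0 eq_le sqr_ge0 andbT.
  by rewrite -uu0; exact: coord_sqr_le.
have := differential_averaging u eps0 (leqnn _).
rewrite /centered au scale0r !subr0.
have /(iter_growth symA (ltW rho0))/(_ (tau eps)) :
    rho ^+ 2 * dot u u <= dot (u *m line_jacobian ff fm fl)
                             (u *m line_jacobian ff fm fl).
  by rewrite -line_differentialE ltW.
rewrite -(eq_iter (line_differentialE _ _ _)).
move=> /le_trans/[apply]; rewrite ler_pM2r // mulnC exprM.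
rewrite ler_sqr ?nnegrE ?exprn_ge0 ?(ltW eps0) ?(ltW rho0) //.
by rewrite leNgt eps_rho.
Qed.

Lemma averaging_time_lower_bound eps : (2 < n)%N -> 0 < eps ->
  n%:R ^+ 2 / 30 * ln (1 / eps) <= (tau eps)%:R.
Proof.
move=> n3 eps0; rewrite div1r lnV ?posrE //.
have N0 : 0 < n%:R :> R by rewrite ltr0n.
have N3 : 3 <= n%:R :> R by rewrite ler_nat.
pose a : R := 30 / n%:R ^+ 2; pose rho := expR (- a).
have a0 : 0 < a by rewrite divr_gt0 ?exprn_gt0.
rewrite leNgt; apply/negP => fast.
have eps_rho : eps < rho ^+ tau eps.
  rewrite -[eps]lnK ?posrE // -expRM_natl ltr_expR lnK ?posrE //.
  have : a * (tau eps)%:R < a * (n%:R ^+ 2 / 30 * - ln eps) by rewrite ltr_pM2l.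
  have -> : a * (n%:R ^+ 2 / 30 * - ln eps) = - ln eps.
    by rewrite /a; field; rewrite gt_eqF.
  lra.
have rho0 : 0 < rho := expR_gt0 _.
have gap : n%:R * (n%:R + 1) * (1 - rho) <= 6 * (1 + rho).
  apply: (line_spectral_gap n1 (line_jacobian_tridiagonal ff fm fl n1)
    line_jacobian_doubly_stochastic rho0) => u su.
  by rewrite -line_differentialE; exact: (differential_contraction eps0 rho0 eps_rho su).
(* From here on the gap at rho = exp(- a) is refuted: exp a >= 1 + a turns it
   into (n (n + 1) - 6) a <= 12, which is false for a = 30 / n^2 and n >= 3. *)
have rho_a : rho * (1 + a) <= 1.
  by rewrite -[leRHS](expRxMexpNx_1 a) mulrC -/rho ler_pM2r // expR_ge1Dx.
have aN : a * n%:R ^+ 2 = 30 by rewrite divfK // gt_eqF ?exprn_gt0.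
have m0 : 0 < n%:R * (n%:R + 1) :> R by rewrite mulr_gt0 //; lra.
have am : (n%:R * (n%:R + 1) - 6) * a <= 12.
  have : (n%:R * (n%:R + 1) - 6) * (1 + a)
      <= (n%:R * (n%:R + 1) + 6) * (rho * (1 + a)).
    by rewrite mulrA ler_pM2r; lra.
  have : (n%:R * (n%:R + 1) + 6) * (rho * (1 + a)) <= n%:R * (n%:R + 1) + 6.
    by rewrite -[leRHS]mulr1 ler_pM2l //; lra.
  lra.
have : (n%:R * (n%:R + 1) - 6) * 30 <= 12 * n%:R ^+ 2 :> R.
  by rewrite -aN mulrA ler_pM2r ?exprn_gt0.
nra.
Qed.

End Averaging.

Theorem theorem1 (R : realType)
  (ffirst : nat -> R * R -> R)
  (fmid : forall n : nat, 'I_n -> R * R * R -> R)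
  (flast : nat -> R * R -> R)
  (dffirst : forall n : nat, (3 <= n)%N ->
     forall p : R * R, differentiable (ffirst n) p)
  (dfmid : forall n : nat, (3 <= n)%N ->
     forall i : 'I_n, (0 < i < n.-1)%N ->
     forall p : R * R * R, differentiable (fmid n i) p)
  (dflast : forall n : nat, (3 <= n)%N ->
     forall p : R * R, differentiable (flast n) p)
  (tau : nat -> R -> nat)
  (htau : forall n : nat, (3 <= n)%N ->
     forall eps : R, 0 < eps ->
     forall t : nat, (tau n eps <= t)%N ->
     forall x0 : 'rV[R]_n, ~ (forall i j : 'I_n, x0 0 i = x0 0 j) ->
     norm2 (trajectory (ffirst n) (fmid n) (flast n) x0 t
              - average x0 *: const_mx 1)
       / norm2 (x0 - average x0 *: const_mx 1) < eps) :
  forall eps : R, 0 < eps ->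
  forall n : nat, (3 <= n)%N ->
  n%:R ^+ 2 / 30%:R * ln (1 / eps) <= (tau n eps)%:R.
Proof.
move=> eps eps0 n n3; have n1 : (1 < n)%N := ltnW n3.
exact: (averaging_time_lower_bound n1 (dffirst n n3) (dfmid n n3) (dflast n n3)
  (htau n n3) n3 eps0).
Qed.
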